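(* Let $1\le r\le n$ be integers and $A\in RB(r,n)$. Then $$\mathrm{per}\!\left(\tfrac1r A\right)\ \le\ (\sqrt2)^n\, F\!\left(\tfrac1r A\right).$$
   Context: $RB(r,n)$ is the set of $n\times n$ $0/1$ matrices all of whose row and column sums equal $r$. $\mathrm{per}$ is the permanent. For a doubly-stochastic $n\times n$ matrix $P$, $F(P)=\prod_{1\le i,j\le n}(1-P(i,j))^{1-P(i,j)}$, with $0^0=1$. *)

(* Defs.v *)
From mathcomp Require Import all_boot all_order all_algebra all_fingroup.
From mathcomp Require Import all_classical all_reals all_analysis.
Set Implicit Arguments. Unset Strict Implicit. Unset Printing Implicit Defensive.
Import Order.TTheory GRing.Theory Num.Theory.
Local Open Scope ring_scope.

Definition per (R : comRingType) (n : nat) (A : 'M[R]_n) : R :=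
  \sum_(s : 'S_n) \prod_(i < n) A i (s i).

Definition RB (R : realType) (r n : nat) (A : 'M[R]_n) : Prop :=
  (forall i j, A i j = 0 \/ A i j = 1) /\
  (forall i, \sum_(j < n) A i j = r%:R) /\
  (forall j, \sum_(i < n) A i j = r%:R).

(* F(P) = prod_{i,j} (1 - P(i,j))^(1 - P(i,j)), with 0^0 = 1 (powR 0 0 = 1). *)
Definition Fdef (R : realType) (n : nat) (P : 'M[R]_n) : R :=
  \prod_(i < n) \prod_(j < n) powR (1 - P i j) (1 - P i j).

(* Main.v *)
Require Import Defs.
From mathcomp Require Import all_boot all_order all_algebra all_fingroup.
From mathcomp Require Import all_classical all_reals all_analysis.
From mathcomp Require Import ring lra.
Import Order.TTheory GRing.Theory Num.Theory.
Local Open Scope ring_scope.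

(* Entropy induction in the style of Bregman's theorem: if [psi] is nonnegative
   on the naturals and [ln N + (N - 1) psi (N - 1) <= N psi N], then
   [ln (per B) <= \sum_i psi (r_i)] for every 0/1 matrix [B] with row sums [r_i].
   Expanding [per B] along a row gives a distribution whose entropy is at most
   the log of its support, i.e. of the row sum; averaging over the rows and
   applying induction to the minors yields the claim.  For
   [psi x = ln (sqrt 2 * x * (1 - 1/x) ^ (x - 1))] the recursion reduces to an
   estimate on second differences of [ln], and [n * psi r] is exactly the
   logarithm of [r ^ n * sqrt 2 ^ n * F (A / r)]. *)

Set Implicit Arguments. Unset Strict Implicit. Unset Printing Implicit Defensive.

Section Permanent.
Variable R : comNzRingType.

Lemma per_scale n (c : R) (A : 'M[R]_n) : per (c *: A) = c ^+ n * per A.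
Proof.
rewrite /per big_distrr /=; apply: eq_bigr => s _.
rewrite -[in c ^+ n](card_ord n) -prodr_const -big_split /=.
by apply: eq_bigr => i _; rewrite mxE.
Qed.

Lemma per_minor n (A : 'M[R]_n.+1) i0 j0 :
  \sum_(s : 'S_n.+1 | s i0 == j0) \prod_k A k (s k)
  = A i0 j0 * per (row' i0 (col' j0 A)).
Proof.
rewrite (reindex (lift_perm i0 j0)); last first.
  pose ulsf i (s : 'S_n.+1) k := odflt k (unlift (s i) (s (lift i k))).
  have ulsfK i (s : 'S_n.+1) k: lift (s i) (ulsf i s k) = s (lift i k).
    rewrite /ulsf; have:= neq_lift i k.
    by rewrite -(can_eq (permK s)) => /unlift_some[] ? ? ->.
  have inj_ulsf: injective (ulsf i0 _).
    move=> s; apply: can_inj (ulsf (s i0) s^-1%g) _ => k'.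
    by rewrite {1}/ulsf ulsfK !permK liftK.
  exists (fun s => perm (inj_ulsf s)) => [s _ | s].
    by apply/permP=> k'; rewrite permE /ulsf lift_perm_lift lift_perm_id liftK.
  move/(s _ =P _) => si0; apply/permP=> k.
  case: (unliftP i0 k) => [k'|] ->; rewrite ?lift_perm_id //.
  by rewrite lift_perm_lift -si0 permE ulsfK.
rewrite /per big_distrr /=.
apply: eq_big => [s | s _]; first by rewrite lift_perm_id eqxx.
rewrite (bigD1_ord i0) //= lift_perm_id; congr (_ * _).
by apply: eq_bigr => k _; rewrite !mxE lift_perm_lift.
Qed.

Lemma sum_perm_weight n (A : 'M[R]_n.+1) i (f : 'I_n.+1 -> R) :
  \sum_(s : 'S_n.+1) (\prod_k A k (s k)) * f (s i)
  = \sum_k A i k * per (row' i (col' k A)) * f k.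
Proof.
rewrite (partition_big (fun s : 'S_n.+1 => s i) predT) //=.
apply: eq_bigr => k _; rewrite -per_minor mulr_suml.
by apply: eq_bigr => s /eqP ->.
Qed.

Lemma per_expand_row n (A : 'M[R]_n.+1) i :
  per A = \sum_k A i k * per (row' i (col' k A)).
Proof.
have := sum_perm_weight A i (fun=> 1).
by under eq_bigr do rewrite mulr1; under [in RHS]eq_bigr do rewrite mulr1.
Qed.

End Permanent.

Section ZeroOneMatrices.
Variable R : realType.

Definition is01 n (B : 'M[R]_n) := forall i j, B i j = 0 \/ B i j = 1.

Definition rowsum n (B : 'M[R]_n) i := \sum_j B i j.

Lemma is01_minor n (B : 'M[R]_n.+1) i k : is01 B -> is01 (row' i (col' k B)).
Proof. by move=> hB a b; rewrite !mxE. Qed.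

Lemma sum_rowsum_minor (f : R -> R) n (B : 'M[R]_n.+1) i k :
  \sum_j f (rowsum (row' i (col' k B)) j)
  = \sum_j f (rowsum B j - B j k) - f (rowsum B i - B i k).
Proof.
rewrite [X in _ = X - _](bigD1_ord i) //= addrC addrK.
apply: eq_bigr => j _; congr f.
by rewrite /rowsum [in RHS](bigD1_ord k) //= addrC addrK; apply: eq_bigr => l _; rewrite !mxE.
Qed.

Lemma rowsum_nat n (B : 'M[R]_n) i : is01 B -> exists N : nat, rowsum B i = N%:R.
Proof.
move=> hB; exists (\sum_(j < n) nat_of_bool (B i j == 1%R))%N.
rewrite natr_sum; apply: eq_bigr => j _.
by case: (hB i j) => ->; rewrite ?eqxx // eq_sym oner_eq0.
Qed.

Lemma sum_row01 (f : R -> R) n (B : 'M[R]_n) j : is01 B ->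
  \sum_k f (rowsum B j - B j k)
  = rowsum B j * f (rowsum B j - 1) + (n%:R - rowsum B j) * f (rowsum B j).
Proof.
have -> : n%:R = \sum_(k < n) (1 : R) by rewrite sumr_const card_ord.
move=> hB; rewrite /rowsum -sumrB !mulr_suml -big_split /=.
by apply: eq_bigr => k _; case: (hB j k) => ->; rewrite ?subr0; ring.
Qed.

Lemma prod_perm01 n (B : 'M[R]_n) (s : 'S_n) : is01 B ->
  \prod_k B k (s k) = 0 \/ (\prod_k B k (s k) = 1 /\ forall j, B j (s j) = 1).
Proof.
move=> hB; case: (pickP (fun j => B j (s j) == 0)) => [j /eqP Bj0 | no0].
  by left; rewrite (bigD1 j) //= Bj0 mul0r.
have all1 j : B j (s j) = 1.
  by case: (hB j (s j)) => // Bj0; move: (no0 j); rewrite Bj0 eqxx.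
by right; split=> //; rewrite big1.
Qed.

Lemma per01_ge0 n (B : 'M[R]_n) : is01 B -> 0 <= per B.
Proof.
move=> hB; apply: sumr_ge0 => s _.
by case: (prod_perm01 s hB) => [|[]] ->.
Qed.

End ZeroOneMatrices.

Lemma ln_le_subr1 (R : realType) (y : R) : 0 < y -> ln y <= y - 1.
Proof. by move=> y0; have := @le_ln1Dx R (y - 1); rewrite [1 + _]addrC subrK; apply; lra. Qed.

Section LogSum.
Variable R : realType.

Lemma log_sum01_term (x c b : R) :
  0 <= x -> 0 < c -> (b = 0 \/ b = 1) -> (b = 0 -> x = 0) ->
  b * (x - c) <= x * ln x - x * ln c.
Proof.
move=> x0 c0 b01 xb.
have [->|xn0] := eqVneq x 0; first by rewrite ln0 // !mul0r subrr; case: b01 => ->; lra.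
have xpos : 0 < x by rewrite lt0r xn0.
have -> : b = 1 by case: b01 => // /xb; move/eqP: xn0.
have := ln_le_subr1 (divr_gt0 c0 xpos).
rewrite ln_div ?posrE // => /(ler_wpM2l (ltW xpos)).
by rewrite mulrBr mulrBr mulrCA divff ?gt_eqF //; lra.
Qed.

(* The entropy of [x / \sum x] is at most the log of the support size [\sum b]. *)
Lemma entropy_le_ln_support (I : finType) (x b : I -> R) :
  (forall k, 0 <= x k) -> (forall k, b k = 0 \/ b k = 1) ->
  (forall k, b k = 0 -> x k = 0) ->
  (\sum_k x k) * ln (\sum_k x k) <=
  (\sum_k x k) * ln (\sum_k b k) + \sum_k x k * ln (x k).
Proof.
move=> x0 b01 xb.
have b0 k : 0 <= b k by case: (b01 k) => ->.
set S := \sum_k x k; set N := \sum_k b k.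
have [S0|Sn0] := eqVneq S 0.
  have xz k : x k = 0 by move/eqP: S0; rewrite psumr_eq0 // => /allP/(_ k (mem_index_enum _))/eqP.
  by rewrite S0 !mul0r add0r big1 // => k _; rewrite xz mul0r.
have Spos : 0 < S by rewrite lt0r Sn0 sumr_ge0.
have [N0|Nn0] := eqVneq N 0.
  have bz k : b k = 0 by move/eqP: N0; rewrite psumr_eq0 // => /allP/(_ k (mem_index_enum _))/eqP.
  by move: Sn0; rewrite /S big1 ?eqxx // => k _; apply: xb.
have Npos : 0 < N by rewrite lt0r Nn0 sumr_ge0.
have c0 : 0 < S / N by apply: divr_gt0.
have : \sum_k b k * (x k - S / N) <= \sum_k (x k * ln (x k) - x k * ln (S / N)).
  by apply: ler_sum => k _; exact: log_sum01_term (x0 k) c0 (b01 k) (@xb k).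
have -> : \sum_k b k * (x k - S / N) = 0.
  rewrite (eq_bigr (fun k => x k - b k * (S / N))); last first.
    by move=> k _; case: (b01 k) => bk; rewrite bk ?mul0r ?mul1r ?(xb _ bk) //; ring.
  by rewrite sumrB -mulr_suml -/S -/N mulrC mulfVK ?subrr.
by rewrite sumrB -mulr_suml -/S ln_div ?posrE //; lra.
Qed.

End LogSum.

Section EntropyInduction.
Variables (R : realType) (psi : R -> R).
Hypothesis psi_ge0 : forall N : nat, 0 <= psi N%:R.
Hypothesis psi_rec : forall N : nat, (1 <= N)%N ->
  ln (N%:R : R) + (N%:R - 1) * psi (N%:R - 1) <= N%:R * psi N%:R.

Lemma per_entropy_row n (B : 'M[R]_n.+1) i : is01 B ->
  per B * ln (per B) <= \sum_(s : 'S_n.+1) (\prod_k B k (s k)) *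
     (ln (rowsum B i) + ln (B i (s i) * per (row' i (col' (s i) B)))).
Proof.
move=> hB; rewrite (sum_perm_weight B i
  (fun k => ln (rowsum B i) + ln (B i k * per (row' i (col' k B))))).
set Q := fun k => B i k * per (row' i (col' k B)).
have QP : \sum_k Q k = per B by rewrite [RHS](per_expand_row B i).
have Q0 k : 0 <= Q k.
  by rewrite /Q; case: (hB i k) => ->; rewrite ?mul0r ?mul1r //; exact/per01_ge0/is01_minor.
have QB k : B i k = 0 -> Q k = 0 by rewrite /Q => ->; rewrite mul0r.
have := entropy_le_ln_support Q0 (hB i) QB.
rewrite QP => /le_trans; apply.
under [X in _ <= X]eq_bigr do rewrite mulrDr.
by rewrite big_split /= -mulr_suml QP.
Qed.

Lemma sum_ln_minors_le n (B : 'M[R]_n.+1) (s : 'S_n.+1) :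
  (forall C : 'M[R]_n, is01 C -> ln (per C) <= \sum_i psi (rowsum C i)) ->
  is01 B -> (forall j, B j (s j) = 1) ->
  \sum_i (ln (rowsum B i) + ln (per (row' i (col' (s i) B))))
    <= n.+1%:R * \sum_j psi (rowsum B j).
Proof.
move=> IH hB Bs.
have minor_le i : ln (per (row' i (col' (s i) B))) <=
    \sum_j psi (rowsum B j - B j (s i)) - psi (rowsum B i - 1).
  by have := IH _ (is01_minor i (s i) hB); rewrite sum_rowsum_minor Bs.
have row_le j : ln (rowsum B j) + \sum_k psi (rowsum B j - B j k)
    - psi (rowsum B j - 1) <= n.+1%:R * psi (rowsum B j).
  have [N rN] := rowsum_nat j hB.
  have N1 : (1 <= N)%N.
    rewrite -(ler_nat R) -rN /rowsum (bigD1 (s j)) //= Bs lerDl.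
    by apply: sumr_ge0 => k _; case: (hB j k) => ->.
  by have := psi_rec N1; rewrite sum_row01 // rN; lra.
have swap : \sum_i \sum_j psi (rowsum B j - B j (s i))
    = \sum_j \sum_k psi (rowsum B j - B j k).
  rewrite exchange_big; apply: eq_bigr => j _.
  by rewrite [RHS](reindex_inj (@perm_inj _ s)).
rewrite mulr_sumr; apply: le_trans (ler_sum _ (fun j _ => row_le j)).
rewrite sumrB !big_split /= -swap -addrA lerD2l -sumrB.
exact: ler_sum.
Qed.

Theorem ln_per_le_sum_psi n (B : 'M[R]_n) :
  is01 B -> ln (per B) <= \sum_i psi (rowsum B i).
Proof.
elim: n B => [|n IH] B hB.
  rewrite big_ord0 /per (eq_bigr (fun=> 1)) => [|s _]; last by rewrite big_ord0.
  by rewrite sumr_const card_Sn ln1.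
have [P0|Pn0] := eqVneq (per B) 0.
  by rewrite P0 ln0 // sumr_ge0 // => i _; have [N ->] := rowsum_nat i hB; exact: psi_ge0.
have Ppos : 0 < per B by rewrite lt0r Pn0 per01_ge0.
rewrite -(ler_pM2l (mulr_gt0 (ltr0Sn R n) Ppos)).
have -> : n.+1%:R * per B * ln (per B) = \sum_(i < n.+1) per B * ln (per B).
  by rewrite sumr_const card_ord -mulrA mulr_natl.
have -> : n.+1%:R * per B * \sum_i psi (rowsum B i)
    = \sum_(s : 'S_n.+1) (\prod_k B k (s k)) * (n.+1%:R * \sum_i psi (rowsum B i)).
  by rewrite -mulr_suml mulrCA mulrA.
apply: (le_trans (ler_sum _ (fun i _ => per_entropy_row i hB))).
rewrite exchange_big /=; apply: ler_sum => s _; rewrite -mulr_sumr.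
case: (prod_perm01 s hB) => [->|[-> Bs]]; first by rewrite !mul0r.
rewrite !mul1r (eq_bigr (fun i => ln (rowsum B i) + ln (per (row' i (col' (s i) B))))).
  exact: sum_ln_minors_le IH hB Bs.
by move=> i _; rewrite Bs mul1r.
Qed.

End EntropyInduction.

Section LnEstimates.
Variable R : realType.

Lemma ln_sub1_le (y : R) : 1 < y -> ln y - ln (y - 1) <= (y - 1)^-1.
Proof.
move=> y1; have y0 : 0 < y - 1 by lra.
have := ln_le_subr1 (divr_gt0 (lt_trans ltr01 y1) y0).
rewrite ln_div ?posrE; [|lra|lra].
have -> : y / (y - 1) - 1 = (y - 1)^-1 by field; rewrite gt_eqF.
by [].
Qed.

(* Splitting [M / (M - 1)] as [2M / (2M - 1) * (2M - 1) / (2M - 2)] sharpens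
   [ln_sub1_le] just enough for [psi_key] at [m = 4]. *)
Lemma ln_sub1_le_split (M : R) : 1 < M ->
  ln M - ln (M - 1) <= (2 * M - 1)^-1 + (2 * M - 2)^-1.
Proof.
move=> M1; have M0 : 0 < M by lra.
have h1 := @ln_sub1_le (2 * M) ltac:(lra).
have h2 := @ln_sub1_le (2 * M - 1) ltac:(lra).
have e1 : ln (2 * M) = ln 2 + ln M by rewrite lnM ?posrE.
have e2 : ln (2 * M - 1 - 1) = ln 2 + ln (M - 1).
  by rewrite -lnM ?posrE; [congr ln; ring | lra | lra].
have e3 : 2 * M - 1 - 1 = 2 * M - 2 by ring.
by rewrite e1 in h1; rewrite e2 e3 in h2; lra.
Qed.

Lemma ln_second_diff_le (M : R) : 1 < M ->
  ln (M + 1) + ln (M - 1) - 2 * ln M <= - (M ^+ 2)^-1.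
Proof.
move=> M1; have M0 : 0 < M by lra.
have q0 : 0 < (M + 1) * (M - 1) / (M * M) by apply: divr_gt0; apply: mulr_gt0; lra.
have := ln_le_subr1 q0.
rewrite ln_div ?lnM ?posrE; try (apply: mulr_gt0; lra); try lra.
have -> : (M + 1) * (M - 1) / (M * M) - 1 = - (M ^+ 2)^-1 by field; rewrite gt_eqF.
lra.
Qed.

Lemma ln2_ge_half : 1 / 2 <= ln (2 : R).
Proof. by have := @ln_le_subr1 R 2^-1 ltac:(lra); rewrite lnV ?posrE; lra. Qed.

Lemma ln2_sqrt : ln (2 : R) = 2 * ln (Num.sqrt 2).
Proof. by rewrite -{1}(@sqr_sqrtr R 2) ?lnXn ?mulr_natl ?sqrtr_gt0. Qed.

Lemma ln_pow_le (a b : R) (p q : nat) : 0 < a -> 0 < b ->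
  a ^+ p <= b ^+ q -> p%:R * ln a <= q%:R * ln b.
Proof.
move=> a0 b0 h; rewrite !mulr_natl -!lnXn //.
by rewrite ler_ln // posrE exprn_gt0.
Qed.

(* [psi_step] at [N = m + 1], with [psi] unfolded. *)
Lemma psi_key (m : nat) : (2 <= m)%N ->
  (m%:R : R) ^+ 2 * ln (m%:R + 1) + m%:R * (m%:R - 1) * ln (m%:R - 1)
   - m%:R * (2 * m%:R - 1) * ln (m%:R : R) <= ln (Num.sqrt 2).
Proof.
have l2 := ln2_sqrt; have l2g := ln2_ge_half.
case: m => [|[|[|[|m]]]] // _.
- have -> : (2%:R : R) + 1 = 3 by lra.
  have -> : (2%:R : R) - 1 = 1 by lra.
  have -> : (2%:R : R) = 2 by lra.
  have := @ln_pow_le 3 2 8 13 ltac:(lra) ltac:(lra) ltac:(lra).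
  rewrite ln1; lra.
- have -> : (3%:R : R) + 1 = 2 ^+ 2 by lra.
  have -> : (3%:R : R) - 1 = 2 by lra.
  have -> : (3%:R : R) = 3 by lra.
  have := @ln_pow_le 2 3 47 30 ltac:(lra) ltac:(lra) ltac:(lra).
  rewrite lnXn ?mulr_natr; lra.
set M := (m.+4)%:R : R.
have M4 : 4 <= M by rewrite /M ler_nat.
have M0 : 0 < M by lra.
have -> : M ^+ 2 * ln (M + 1) + M * (M - 1) * ln (M - 1) - M * (2 * M - 1) * ln M
    = M ^+ 2 * (ln (M + 1) + ln (M - 1) - 2 * ln M) + M * (ln M - ln (M - 1)).
  by ring.
have c1 : M ^+ 2 * (ln (M + 1) + ln (M - 1) - 2 * ln M) <= -1.
  have := ler_wpM2l (exprn_ge0 2 (ltW M0)) (@ln_second_diff_le M ltac:(lra)).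
  by rewrite mulrN mulfV ?gt_eqF ?exprn_gt0.
have c2 := ler_wpM2l (ltW M0) (@ln_sub1_le_split M ltac:(lra)).
set u := (2 * M - 1)^-1 in c2; set v := (2 * M - 2)^-1 in c2.
have hu : M * u = (1 + u) / 2 by rewrite /u; field; lra.
have hv : M * v = 1 / 2 + v by rewrite /v; field; lra.
have u7 : u <= 7^-1 by rewrite /u lef_pV2 ?posrE; lra.
have v6 : v <= 6^-1 by rewrite /v lef_pV2 ?posrE; lra.
rewrite [M * (u + v)]mulrDr hu hv in c2; lra.
Qed.

End LnEstimates.

Section Psi.
Variable R : realType.

Definition psi (x : R) : R :=
  if x <= 1 then 0 else ln (Num.sqrt 2) + (x - 1) * ln (x - 1) - (x - 2) * ln x.

Lemma psi_le1 (x : R) : x <= 1 -> psi x = 0.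
Proof. by rewrite /psi => ->. Qed.

Lemma psi_gt1 (x : R) : 1 < x ->
  psi x = ln (Num.sqrt 2) + (x - 1) * ln (x - 1) - (x - 2) * ln x.
Proof. by rewrite /psi leNgt => ->. Qed.

Lemma psi_step (N : nat) : (1 <= N)%N ->
  ln (N%:R : R) + (N%:R - 1) * psi (N%:R - 1) <= N%:R * psi N%:R.
Proof.
have l2 := @ln2_sqrt R; have l2g := @ln2_ge_half R.
case: N => [|[|[|m]]] // _.
- by rewrite subrr mul0r !psi_le1 ?ln1; lra.
- rewrite psi_le1 ?psi_gt1; [|lra|lra].
  have -> : (2%:R : R) - 1 = 1 by lra.
  by rewrite !ln1; lra.
have := @psi_key R m.+2 isT.
rewrite -[m.+3%:R]natr1 addrK; set M := (m.+2)%:R : R.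
have M2 : 2 <= M by rewrite /M ler_nat.
rewrite !psi_gt1; [|lra|lra].
have -> : M + 1 - 1 = M by ring.
have -> : M + 1 - 2 = M - 1 by ring.
nra.
Qed.

Lemma psi_nat_ge0 (N : nat) : 0 <= psi (N%:R : R).
Proof.
elim: N => [|N IH]; first by rewrite psi_le1.
have := psi_step (isT : (0 < N.+1)%N); rewrite -natr1 addrK.
have l0 : 0 <= ln (N%:R + 1 : R) by apply: ln_ge0; rewrite lerDr.
have N0 : 0 <= (N%:R : R) by [].
rewrite -(pmulr_rge0 _ (ltr0Sn R N)) -natr1; nra.
Qed.

Lemma psi_nat_le (r : nat) : (1 <= r)%N ->
  psi r%:R <= ln r%:R + ln (Num.sqrt 2) + r%:R * ((1 - r%:R^-1) * ln (1 - r%:R^-1)).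
Proof.
have l2 := @ln2_sqrt R; have l2g := @ln2_ge_half R.
case: r => [|[|m]] // _.
  by rewrite psi_le1 // invr1 subrr mul0r mulr0 ln1; lra.
set M := (m.+2)%:R : R.
have M2 : 2 <= M by rewrite /M ler_nat.
rewrite psi_gt1; last lra.
have -> : 1 - M^-1 = (M - 1) / M by field; lra.
rewrite ln_div ?posrE; [|lra|lra].
have -> : M * ((M - 1) / M * (ln (M - 1) - ln M)) = (M - 1) * (ln (M - 1) - ln M).
  by field; lra.
lra.
Qed.

End Psi.

Lemma powR_self (R : realType) (q : R) : powR q q = expR (q * ln q).
Proof. by rewrite /powR; case: eqP => [->|_] //; rewrite mul0r expR0. Qed.

Lemma Fdef_scaled_RB (R : realType) (r n : nat) (A : 'M[R]_n) : RB r A ->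
  Fdef (r%:R^-1 *: A) = expR (n%:R * (r%:R * ((1 - r%:R^-1) * ln (1 - r%:R^-1)))).
Proof.
move=> [A01 [rowA _]]; set t := (1 - r%:R^-1) * ln (1 - r%:R^-1).
have entry i j : powR (1 - (r%:R^-1 *: A) i j) (1 - (r%:R^-1 *: A) i j) = expR (A i j * t).
  by rewrite mxE powR_self; case: (A01 i j) => ->; rewrite ?mulr0 ?mulr1 ?subr0 ?ln1 ?mulr0 ?mul0r ?mul1r.
rewrite /Fdef (eq_bigr (fun=> expR (r%:R * t))) => [|i _].
  by rewrite -expR_sum sumr_const card_ord [in RHS]mulr_natl.
rewrite (eq_bigr (fun j => expR (A i j * t))) => [|j _]; last exact: entry.
by rewrite -expR_sum -mulr_suml rowA.
Qed.

Lemma per_RB_le (R : realType) (r n : nat) (A : 'M[R]_n) : RB r A ->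
  per A <= expR (n%:R * psi r%:R).
Proof.
move=> [A01 [rowA _]].
have := ln_per_le_sum_psi (@psi_nat_ge0 R) (@psi_step R) A01.
rewrite /rowsum (eq_bigr (fun=> psi r%:R)) => [|i _]; last by rewrite rowA.
rewrite sumr_const card_ord => ln_le.
have [P0|Pn0] := eqVneq (per A) 0; first by rewrite P0 expR_ge0.
have Ppos : 0 < per A by rewrite lt0r Pn0 per01_ge0.
by rewrite -ler_ln ?posrE ?expR_gt0 // expRK mulr_natl.
Qed.

Lemma scaled_expR_psi_le (R : realType) (r n : nat) : (1 <= r)%N ->
  (r%:R^-1) ^+ n * expR (n%:R * psi (r%:R : R))
  <= Num.sqrt 2 ^+ n * expR (n%:R * (r%:R * ((1 - r%:R^-1) * ln (1 - r%:R^-1)))).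
Proof.
move=> r1; have r0 : 0 < (r%:R : R) by rewrite ltr0n.
have expR_pow (x : R) : 0 < x -> x ^+ n = expR (n%:R * ln x).
  by move=> x0; rewrite mulr_natl -lnXn ?lnK // posrE exprn_gt0.
rewrite expR_pow ?invr_gt0 // expR_pow ?sqrtr_gt0 // -!expRD ler_expR lnV ?posrE //.
rewrite -!mulrDr ler_wpM2l //.
by have := psi_nat_le R r1; lra.
Qed.

Unset Implicit Arguments.

Theorem mainTheorem9 (R : realType) (r n : nat) (A : 'M[R]_n) :
  (1 <= r)%N -> (r <= n)%N -> RB r A ->
  per ((r%:R)^-1 *: A) <= (Num.sqrt (2 : R)) ^+ n * Fdef ((r%:R)^-1 *: A).
Proof.
move=> r1 _ hA.
rewrite Fdef_scaled_RB // per_scale.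
apply: le_trans _ (@scaled_expR_psi_le R r n r1).
by rewrite ler_wpM2l ?exprn_ge0 ?invr_ge0 // per_RB_le.
Qed.
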